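(* Let $\omega=\omega(n)$ be any function with $\omega(n)\to\infty$ as $n\to\infty$, let $\gamma\in(0,1)$ be a constant, and set $z=z(n,\omega):=\omega\sqrt{n}$. If the edge-probability $p=p(n)$ satisfies $0<p\le\gamma$, then there is an interval of length at most $L=L(n,p,\gamma)$ that contains $\chi(G_{n,p})$ with high probability, where $$L:=\frac{Czp}{\log(zp/\log n)}\quad\text{if } zp\gg\log n,\qquad L:=\frac{C\log n}{\log(\log n/(zp))}\quad\text{if } zp\ll\log n,$$ and $C=C(\gamma)>0$ is a constant (depending only on $\gamma$).
   Context: $G_{n,p}$ denotes the binomial random graph on vertex set $[n]$ in which each pair of vertices is an edge independently with probability $p$; $\chi$ denotes the chromatic number. For positive functions, $a\ll b$ means $a/b\to0$ as $n\to\infty$. ''With high probability'' means with probability tending to $1$ as $n\to\infty$. ''There is an interval of length at most $L(n)$ that contains $\chi(G_{n,p})$ with high probability'' means there exist intervals $I_n$ of length at most $L(n)$ with $\Pr(\chi(G_{n,p})\in I_n)\to1$. *)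

(* Defs.v *)
From HB Require Import structures.
From mathcomp Require Import all_boot all_order all_algebra.
From mathcomp Require Import all_classical all_reals all_analysis.
Set Implicit Arguments. Unset Strict Implicit. Unset Printing Implicit Defensive.
Import Order.TTheory GRing.Theory Num.Theory.
Local Open Scope ring_scope.

(* A simple graph on vertex set [n] = 'I_n is encoded by its edge set
   E : {set 'I_n * 'I_n}, where the edge {i,j} with i < j is the pair (i,j).
   The sample space of G_{n,p} consists of the E contained in [upair n]. *)
Definition upair (n : nat) : {set 'I_n * 'I_n} := [set ij : 'I_n * 'I_n | (val ij.1 < val ij.2)%N].

Definition gnp_weight (R : realType) (n : nat) (p : R) (E : {set 'I_n * 'I_n}) : R :=
  p ^+ #|E| * (1 - p) ^+ (#|upair n| - #|E|).

Definition gnp_prob (R : realType) (n : nat) (p : R) (A : pred {set 'I_n * 'I_n}) : R :=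
  \sum_(E : {set 'I_n * 'I_n} | (E \subset upair n) && A E) gnp_weight p E.

Definition adj (n : nat) (E : {set 'I_n * 'I_n}) (i j : 'I_n) : bool :=
  ((i, j) \in E) || ((j, i) \in E).

Definition is_coloring (n k : nat) (E : {set 'I_n * 'I_n}) (f : {ffun 'I_n -> 'I_k}) : bool :=
  [forall i, forall j, ((i != j) && adj E i j) ==> (f i != f j)].

Definition colorable (n : nat) (E : {set 'I_n * 'I_n}) (k : nat) : bool :=
  [exists f : {ffun 'I_n -> 'I_k}, is_coloring E f].

Lemma colorable_n (n : nat) (E : {set 'I_n * 'I_n}) : exists k, colorable E k.
Proof.
exists n; apply/existsP; exists [ffun i => i].
apply/forallP => i; apply/forallP => j; rewrite !ffunE.
by apply/implyP => /andP [].
Qed.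

Definition chi (n : nat) (E : {set 'I_n * 'I_n}) : nat := ex_minn (colorable_n E).

(* Main.v *)
(** Shamir-Spencer argument. Let [a] be least with P(chi <= a) not too small, and
    let Y be the number of vertices that have to be deleted to make the graph
    a-colourable. Re-randomising the pairs below one vertex changes Y by at most
    one, so Var Y <= n, and Chebyshev's inequality bounds Y by z = omega sqrt n
    with high probability. It remains to colour every set of at most z vertices
    with L further colours.
    - If zp << log n, every such set spans so few edges that it is degenerate.
    - If zp >> log n, put d = zp / log n. Sets of size at most z / d^(1/4) are
      again handled by degeneracy. A larger set contains an independent set of
      order (log d) / p: otherwise repeatedly removing maximal independent sets
      exhibits many disjoint small sets each dominating the same large set, which
      is so unlikely that a union bound over all such configurations works. *)

Require Import Defs.
From mathcomp Require Import all_boot all_order all_algebra.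
From mathcomp Require Import all_classical all_reals all_analysis.
From mathcomp Require Import ring lra zify fintype finset.
Set Implicit Arguments. Unset Strict Implicit. Unset Printing Implicit Defensive.
Import Order.TTheory GRing.Theory Num.Theory.
Import numFieldNormedType.Exports.
Local Open Scope ring_scope.

(** * Expectation and variance over independent Bernoulli coordinates *)

Section BernoulliProduct.
Variables (R : realType) (T : finType).
Implicit Types (p q x : R) (A B D F : {set T}) (f g : {set T} -> R).

(* For [p + q = 1] this is the expectation of [f] on a [p]-random subset of [D]; the
   instance [q = 1] serves to sum [p ^+ #|A|] over all [A]. *)
Definition bernsum p q D f : R :=
  \sum_(A : {set T} | A \subset D) p ^+ #|A| * q ^+ (#|D| - #|A|) * f A.

Lemma eq_bernsum p q D f g : (forall A, A \subset D -> f A = g A) ->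
  bernsum p q D f = bernsum p q D g.
Proof. by move=> fg; apply: eq_bigr => A AD; rewrite fg. Qed.

Lemma setUI_disjoint D F A B : [disjoint D & F] -> A \subset D -> B \subset F ->
  (A :|: B) :&: D = A /\ (A :|: B) :&: F = B.
Proof.
move=> dis AD BF.
have BD : B :&: D = set0.
  by apply/eqP; rewrite setI_eq0 disjoint_sym; apply: disjointWr BF dis.
have AF : A :&: F = set0 by apply/eqP; rewrite setI_eq0; apply: disjointWl AD dis.
by rewrite !setIUl BD AF (setIidPl AD) (setIidPl BF) setU0 set0U.
Qed.

Lemma cardsU_disjoint A B : [disjoint A & B] -> #|A :|: B| = (#|A| + #|B|)%N.
Proof. by rewrite -setI_eq0 => /eqP dis; rewrite cardsU dis cards0 subn0. Qed.

Lemma bernsumU p q D F f : [disjoint D & F] ->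
  bernsum p q (D :|: F) f =
  bernsum p q D (fun A => bernsum p q F (fun B => f (A :|: B))).
Proof.
move=> dis; rewrite /bernsum.
under [RHS]eq_bigr => A _ do rewrite mulr_sumr.
rewrite pair_big_dep /=.
rewrite (reindex_onto (fun AB : {set T} * {set T} => AB.1 :|: AB.2)
    (fun A => (A :&: D, A :&: F))) /=; last first.
  by move=> A AD; rewrite -setIUr; apply/setIidPl.
apply: eq_big => [[A B]|[A B]] /=.
  apply/andP/andP => [[sAB /eqP[<- <-]]|[AD BF]]; first by rewrite !subsetIr.
  by have [-> ->] := setUI_disjoint dis AD BF; rewrite setUSS.
move=> /andP[sAB /eqP[eA eB]].
have AD : A \subset D by rewrite -eA subsetIr.
have BF : B \subset F by rewrite -eB subsetIr.
have disAB : [disjoint A & B] by apply: disjointWl AD _; apply: disjointWr BF _.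
rewrite !cardsU_disjoint //.
have := subset_leq_card AD; have := subset_leq_card BF => leB leA.
have -> : (#|D| + #|F| - (#|A| + #|B|) = (#|D| - #|A|) + (#|F| - #|B|))%N by lia.
by rewrite !exprD; ring.
Qed.

Lemma bernsum0 p q f : bernsum p q set0 f = f set0.
Proof.
rewrite /bernsum (big_pred1 set0) => [|A]; last by rewrite subset0.
by rewrite cards0 subnn !expr0 !mul1r.
Qed.

Lemma bernsum1 p q e f : bernsum p q [set e] f = q * f set0 + p * f [set e].
Proof.
rewrite /bernsum (bigD1 set0) ?sub0set //= (big_pred1 [set e]) => [|A].
  by rewrite cards0 cards1 subnn subn0 !expr0 !expr1 !mul1r mulr1.
rewrite subset1 /=; have [->|_] /= := eqVneq A [set e]; last exact: andbN.
by apply/eqP => /setP/(_ e); rewrite !inE eqxx.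
Qed.

Lemma bernsumZ p q D c f : bernsum p q D (fun A => c * f A) = c * bernsum p q D f.
Proof. by rewrite /bernsum mulr_sumr; apply: eq_bigr => A _; rewrite mulrCA. Qed.

Lemma bernsumD p q D f g :
  bernsum p q D (fun A => f A + g A) = bernsum p q D f + bernsum p q D g.
Proof. by rewrite /bernsum -big_split; apply: eq_bigr => A _; rewrite mulrDr. Qed.

Lemma bernsumB p q D f g :
  bernsum p q D (fun A => f A - g A) = bernsum p q D f - bernsum p q D g.
Proof. by rewrite /bernsum -sumrB; apply: eq_bigr => A _; rewrite mulrBr. Qed.

(** The binomial theorem, by splitting off one element of [D]. It later gives total mass one, the
    exponential moment of an edge count, and sums of powers over all vertex sets. *)
Lemma bernsum_exp p q x D : bernsum p q D (fun A => x ^+ #|A|) = (q + p * x) ^+ #|D|.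
Proof.
have [n] := ubnP #|D|; elim: n D => // n IH D leD.
have [->|[e eD]] := set_0Vmem D; first by rewrite bernsum0 cards0.
have dis : [disjoint [set e] & D :\ e].
  by rewrite disjoints1 !inE eqxx.
have cD : #|D| = #|D :\ e|.+1 by rewrite (cardsD1 e D) eD.
rewrite -{1}(setD1K eD) bernsumU // bernsum1 cD exprS -IH; last by rewrite -ltnS -cD.
rewrite mulrDl; congr (_ + _).
  by congr (_ * _); apply: eq_bernsum => A _; rewrite set0U.
rewrite -mulrA; congr (_ * _); rewrite -bernsumZ; apply: eq_bernsum => A AD.
by rewrite cardsU_disjoint ?cards1 ?exprS //; apply: disjointWr AD _.
Qed.

Lemma bernsum_cst p q D c : p + q = 1 -> bernsum p q D (fun=> c) = c.
Proof.
move=> pq; rewrite -[RHS]mulr1 -(expr1n R #|D|).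
rewrite -[in RHS]pq addrC -[p in RHS]mulr1 -bernsum_exp -bernsumZ.
by apply: eq_bernsum => A _; rewrite expr1n mulr1.
Qed.

Lemma ler_bernsum p q D f g : 0 <= p -> 0 <= q ->
  (forall A, A \subset D -> f A <= g A) -> bernsum p q D f <= bernsum p q D g.
Proof.
by move=> p0 q0 fg; apply: ler_sum => A AD; rewrite ler_wpM2l ?mulr_ge0 ?exprn_ge0 ?fg.
Qed.

Lemma bernsum_sum p q D (I : finType) (P : pred I) (F : I -> {set T} -> R) :
  bernsum p q D (fun A => \sum_(i | P i) F i A) = \sum_(i | P i) bernsum p q D (F i).
Proof.
rewrite /bernsum exchange_big /=; apply: eq_bigr => A _.
by rewrite mulr_sumr.
Qed.

Lemma bernsum_restrict p q D F f : p + q = 1 -> F \subset D ->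
  bernsum p q D (fun A => f (A :&: F)) = bernsum p q F f.
Proof.
move=> pq FD; have dis : [disjoint F & D :\: F].
  by rewrite -setI_eq0 setIDA setDIl setDv set0I.
have {1}-> : D = F :|: (D :\: F) by rewrite -{1}(setID D F) (setIidPr FD).
rewrite bernsumU //; apply: eq_bernsum => A AF.
rewrite -[RHS](@bernsum_cst p q (D :\: F)) //; apply: eq_bernsum => B BF.
by have [-> _] := setUI_disjoint dis AF BF.
Qed.

Lemma bernsum_eq0 p q D : bernsum p q D (fun A => (A == set0)%:R) = q ^+ #|D|.
Proof.
rewrite /bernsum (bigD1 set0) ?sub0set //= big1 => [|A /andP[_ /negbTE->]].
  by rewrite cards0 subn0 expr0 mul1r eqxx mulr1 addr0.
by rewrite mulr0.
Qed.

(** Disjoint blocks are hit independently, and a block of at most [K] elements is missed with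
    probability at least [q ^+ K]. The induction splits off one block at a time. *)
Lemma bernsum_hit p q K (I : finType) (F : I -> {set T}) D (Q : {set I}) :
  p + q = 1 -> 0 <= p -> 0 <= q ->
  {in Q, forall i, F i \subset D /\ (#|F i| <= K)%N} ->
  {in Q &, forall i j, i != j -> [disjoint F i & F j]} ->
  bernsum p q D (fun A => [forall i in Q, A :&: F i != set0]%:R)
    <= (1 - q ^+ K) ^+ #|Q|.
Proof.
move=> pq p0 q0; have q1 : q <= 1 by rewrite -pq lerDr.
have [n] := ubnP #|Q|; elim: n D Q => // n IH D Q leQ FD dF.
have [->|[i iQ]] := set_0Vmem Q.
  rewrite cards0 expr0 -[leRHS](bernsum_cst D 1 pq).
  by apply: ler_bernsum => // A _; rewrite lern1 leq_b1.
have cQ : #|Q| = #|Q :\ i|.+1 by rewrite (cardsD1 i Q) iQ.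
have [FiD FiK] := FD i iQ.
have dis : [disjoint F i & D :\: F i].
  by rewrite -setI_eq0 setIDA setDIl setDv set0I.
have {1}-> : D = F i :|: (D :\: F i) by rewrite -{1}(setID D (F i)) (setIidPr FiD).
rewrite bernsumU //.
pose rest B := [forall j in Q :\ i, B :&: F j != set0].
(* The block [F i] is hit exactly when [A] is nonempty, and the other blocks see only [B], so the
   indicator factors. *)
have -> : bernsum p q (F i) (fun A => bernsum p q (D :\: F i)
     (fun B => [forall i in Q, (A :|: B) :&: F i != set0]%:R)) =
   bernsum p q (F i) (fun A => bernsum p q (D :\: F i) (fun B => (rest B)%:R)
      * (1 - (A == set0)%:R)).
  apply: eq_bernsum => A AF; rewrite mulrC -bernsumZ; apply: eq_bernsum => B BF.
  have -> : [forall i in Q, (A :|: B) :&: F i != set0] = (A != set0) && rest B.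
    have [ABF _] := setUI_disjoint dis AF BF.
    have ABj j : j \in Q :\ i -> (A :|: B) :&: F j = B :&: F j.
      rewrite !inE => /andP[ji jQ]; rewrite setIUl; apply/setUidPr.
      suff -> : A :&: F j = set0 by rewrite sub0set.
      apply/eqP; rewrite setI_eq0; apply: disjointWl AF _.
      by apply: dF => //; rewrite eq_sym.
    apply/forallP/andP => [H|[A0 /forallP H] j].
      split; first by have := H i; rewrite iQ ABF.
      apply/forallP => j; apply/implyP => jQ; rewrite -ABj //.
      by have := H j; have := jQ; rewrite !inE => /andP[_ ->].
    apply/implyP => jQ; have [->|ji] := eqVneq j i; first by rewrite ABF.
    by have := H j; rewrite !inE ji jQ /= ABj // !inE ji jQ.
  by case: (A == set0); case: (rest B) => /=; rewrite ?subrr ?subr0 ?mulr1 ?mul0r ?mul1r.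
rewrite bernsumZ bernsumB bernsum_cst // bernsum_eq0 mulrC cQ exprS.
have qF : 0 <= 1 - q ^+ #|F i| by rewrite subr_ge0 exprn_ile1.
apply: ler_pM => //.
- rewrite -(bernsum_cst (D :\: F i) 0 pq); apply: ler_bernsum => // A _.
- by rewrite lerD2l lerN2 ler_wiXn2l.
- apply: IH; first by rewrite -ltnS -cQ.
  + move=> j; rewrite !inE => /andP[ji jQ]; have [FjD ->] := FD j jQ; split=> //.
    by rewrite subsetD FjD dF.
  + by move=> j k; rewrite !inE => /andP[_ jQ] /andP[_ kQ]; apply: dF.
Qed.

Definition bernvar p q D f : R :=
  bernsum p q D (fun A => f A ^+ 2) - bernsum p q D f ^+ 2.

Lemma bernsum_sqrB p q D f c : p + q = 1 ->
  bernsum p q D (fun A => (f A - c) ^+ 2) =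
  bernvar p q D f + (bernsum p q D f - c) ^+ 2.
Proof.
move=> pq; rewrite /bernvar.
rewrite (@eq_bernsum _ _ _ _ (fun A => f A ^+ 2 - ((c *+ 2) * f A - c ^+ 2))); last first.
  by move=> A _; ring.
by rewrite !bernsumB bernsumZ bernsum_cst //; ring.
Qed.

(* Condition on the first block: the conditional means still have oscillation at
   most 1 in that block, hence variance at most 1. *)
Lemma bernvar_lipschitz p q (I : eqType) (r : seq I) (F : I -> {set T}) f :
  p + q = 1 -> 0 <= p -> 0 <= q -> uniq r ->
  {in r &, forall i j, i != j -> [disjoint F i & F j]} ->
  {in r, forall i A B, A :\: F i = B :\: F i -> `|f A - f B| <= 1} ->
  bernvar p q (\bigcup_(i <- r) F i) f <= (size r)%:R.
Proof.
move=> pq p0 q0; elim: r f => [|i r IH] f /=.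
  by move=> *; rewrite big_nil /bernvar !bernsum0 subrr.
move=> /andP[ir ur] dF lip; rewrite big_cons.
set D := \bigcup_(i <- r) F i.
have dis : [disjoint F i & D].
  rewrite -setI_eq0 /D big_distrr /=; apply/eqP; apply: big1_seq => j /= jr.
  apply/eqP; rewrite setI_eq0; apply: dF; rewrite ?inE ?eqxx ?jr ?orbT //.
  by apply: contraNneq ir => ->.
pose h A := bernsum p q D (fun B => f (A :|: B)).
(* Law of total variance, conditioning on the first block. *)
have -> : bernvar p q (F i :|: D) f =
   bernsum p q (F i) (fun A => bernvar p q D (fun B => f (A :|: B)))
   + bernvar p q (F i) h.
  by rewrite /bernvar !bernsumU // bernsumB -/h; ring.
have hle A : `|h A - h set0| <= 1 \/ ~~ (A \subset F i).
  have [AF|] := boolP (A \subset F i); [left|by right].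
  rewrite /h -bernsumB ler_norml -[X in X <= _ <= _](bernsum_cst D _ pq)
    -[X in _ <= _ <= X](bernsum_cst D _ pq).
  have lipA B : `|f (A :|: B) - f (set0 :|: B)| <= 1.
    apply: (lip i); rewrite ?inE ?eqxx //; rewrite !setDUl set0D set0U.
    by move: AF; rewrite -setD_eq0 => /eqP->; rewrite set0U.
  apply/andP; split; apply: ler_bernsum => // B _;
    by have := lipA B; rewrite ler_norml => /andP[].
(* The variance is at most the second moment about [h set0], and [h] stays within 1 of that
   value. *)
have var1 : bernvar p q (F i) h <= 1.
  have := bernsum_sqrB (F i) h (h set0) pq => /esym eqv.
  have : bernvar p q (F i) h <= bernsum p q (F i) (fun A => (h A - h set0) ^+ 2).
    by rewrite -eqv lerDl sqr_ge0.
  move=> /le_trans; apply; rewrite -[leRHS](bernsum_cst (F i) 1 pq).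
  apply: ler_bernsum => // A AF; case: (hle A) => [|/negP//].
  by rewrite -real_normK ?num_real // => ?; rewrite exprn_ile1.
rewrite -natr1 lerD // -[leRHS](bernsum_cst (F i) _ pq).
apply: ler_bernsum => // A _; apply: IH => //.
  by move=> j k jr kr; apply: dF; rewrite inE ?jr ?kr orbT.
by move=> j jr B B' eqB; apply: (lip j); rewrite ?inE ?jr ?orbT // !setDUl eqB.
Qed.

End BernoulliProduct.

(** * Colourings of vertex subsets and the vertex-exposure blocks *)

Section Coloring.
Variable n : nat.
Implicit Types (E : {set 'I_n * 'I_n}) (W U I : {set 'I_n}) (k : nat).

(** Colours are natural numbers, bounded only on [W], so palettes can be shifted and joined without
    casts between ordinal types. *)
Definition proper_on E W k := exists f : 'I_n -> nat,
  {in W, forall i, (f i < k)%N} /\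
  {in W &, forall i j, i != j -> adj E i j -> f i != f j}.

Definition independent E W := [forall i in W, forall j in W, (i != j) ==> ~~ adj E i j].

Lemma independentP E W :
  reflect {in W &, forall i j, i != j -> ~~ adj E i j} (independent E W).
Proof.
apply: (iffP forall_inP) => [H i j iW jW ij|H i iW].
  by have /forall_inP/(_ j jW)/implyP/(_ ij) := H i iW.
by apply/forall_inP => j jW; apply/implyP; apply: H.
Qed.

Lemma adjC E i j : adj E i j = adj E j i.
Proof. by rewrite /adj orbC. Qed.

Lemma proper_on0 E k : proper_on E set0 k.
Proof. by exists (fun=> 0%N); split=> [i|i j]; rewrite inE. Qed.

Lemma proper_onU E U W k l : proper_on E U k -> proper_on E W l ->
  proper_on E (U :|: W) (k + l).
Proof.
move=> [f [fk fE]] [g [gl gE]].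
exists (fun i => if i \in U then f i else (k + g i)%N); split=> [i|i j].
  rewrite inE; case: ifP => [iU _|_ /= iW]; first exact: ltn_addr (fk _ iU).
  by rewrite ltn_add2l gl.
rewrite !inE; case: ifP => [iU _|_ /= iW]; case: ifP => [jU _|_ /= jW] ij Eij.
- exact: fE.
- by rewrite neq_ltn ltn_addr ?fk.
- by rewrite neq_ltn orbC ltn_addr ?fk.
- by rewrite eqn_add2l gE.
Qed.

Lemma proper_on_independent E I : independent E I -> proper_on E I 1.
Proof.
move=> /independentP ind; exists (fun=> 0%N); split=> // i j iI jI ij.
by rewrite (negbTE (ind i j iI jI ij)).
Qed.

Lemma colorableP E k : colorable E k <-> proper_on E setT k.
Proof.
split=> [/existsP[f /forallP fE]|[f [fk fE]]].
  exists (fun i => val (f i)); split=> [i _|i j _ _ ij Eij]; first exact: ltn_ord.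
  by have /forallP/(_ j) := fE i; rewrite ij Eij.
apply/existsP; exists [ffun i => Ordinal (fk i (in_setT i))].
apply/forallP => i; apply/forallP => j; apply/implyP => /andP[ij Eij].
by rewrite !ffunE -val_eqE /=; apply: fE.
Qed.

Lemma chi_leP E k : (chi E <= k)%N <-> proper_on E setT k.
Proof.
rewrite /chi; case: ex_minnP => m /colorableP[f [fm fE]] mmin; split=> [mk|].
  by exists f; split=> // i iT; apply: leq_trans mk; apply: fm.
by move/colorableP/mmin.
Qed.

(* The random variable Y of the introduction. *)
Definition deficit a E : nat :=
  #|[arg min_(W < setT | `[< proper_on E (~: W) a >]) #|W|]|.

Lemma deficitP a E :
  (exists2 W, proper_on E (~: W) a & #|W| = deficit a E) /\
  (forall W, proper_on E (~: W) a -> (deficit a E <= #|W|)%N).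
Proof.
rewrite /deficit; case: arg_minnP => [|W /asboolP EW Wmin].
  by rewrite setCT; apply/asboolP; apply: proper_on0.
by split; [exists W|move=> U /asboolP; apply: Wmin].
Qed.

(** The pairs with larger endpoint [i]: these [n] disjoint blocks cover [upair n], one independent
    block per vertex. *)
Definition backstar (i : 'I_n) : {set 'I_n * 'I_n} := [set e in upair n | e.2 == i].

(** Once [i] is deleted as well, the two graphs agree on all remaining pairs, so the colouring for
    [E] also works for [E']. *)
Lemma deficit_leD1 a i E E' : E :\: backstar i = E' :\: backstar i ->
  (deficit a E' <= (deficit a E).+1)%N.
Proof.
move=> eqE; have [[W [f [fa fE]] <-] _] := deficitP a E.
have [_ /(_ (i |: W))] := deficitP a E'.
move=> H; apply: leq_trans (H _) _; last first.
  by rewrite cardsU1 -add1n leq_add2r leq_b1.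
exists f; split=> [j|j k].
  by rewrite !inE negb_or => /andP[_ jW]; apply: fa; rewrite inE.
rewrite !inE !negb_or => /andP[ji jW] /andP[ki kW] jk Ejk.
apply: fE; rewrite ?inE //; move: Ejk.
have memE u v : v != i -> ((u, v) \in E') = ((u, v) \in E).
  move=> vi; have /setP/(_ (u, v)) := eqE.
  by rewrite !inE /= (negbTE vi) andbF.
by rewrite /adj !memE.
Qed.

Lemma upair_backstar : upair n = \bigcup_(i <- enum 'I_n) backstar i.
Proof.
rewrite big_enum /=; apply/setP => e; apply/idP/bigcupP => [eD|[i _]].
  by exists e.2; rewrite // inE eD eqxx.
by rewrite inE => /andP[].
Qed.

Lemma card_upair : (#|upair n| <= n ^ 2)%N.
Proof.
by apply: leq_trans (max_card _) _; rewrite card_prod card_ord -mulnn.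
Qed.

End Coloring.

(** * Concentration of the chromatic number up to a small deleted set *)

Section RandomGraph.
Variables (R : realType) (n : nat) (p : R).
Hypothesis p01 : 0 <= p <= 1.
Implicit Types (A B : pred {set 'I_n * 'I_n}).

Let p0 : 0 <= p. Proof. by case/andP: p01. Qed.
Let q0 : 0 <= 1 - p. Proof. by rewrite subr_ge0; case/andP: p01. Qed.
Let pq : p + (1 - p) = 1. Proof. by rewrite addrC subrK. Qed.

Lemma gnp_probE A :
  gnp_prob p A = bernsum p (1 - p) (upair n) (fun E => (A E)%:R).
Proof.
rewrite /gnp_prob /bernsum /gnp_weight big_mkcondr; apply: eq_bigr => E _.
by case: (A E); rewrite ?mulr1 ?mulr0.
Qed.

Lemma gnp_prob_le A B : (forall E, A E -> B E) -> gnp_prob p A <= gnp_prob p B.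
Proof.
move=> AB; rewrite !gnp_probE; apply: ler_bernsum => // E _.
by rewrite ler_nat; case EA: (A E) => //; rewrite (AB E EA).
Qed.

Lemma gnp_prob_le1 A : gnp_prob p A <= 1.
Proof.
rewrite gnp_probE -[leRHS](bernsum_cst (upair n) 1 pq); apply: ler_bernsum => // E _.
by rewrite lern1 leq_b1.
Qed.

Lemma gnp_prob_leU A B C : (forall E, A E -> B E || C E) ->
  gnp_prob p A <= gnp_prob p B + gnp_prob p C.
Proof.
move=> ABC; rewrite !gnp_probE -bernsumD; apply: ler_bernsum => // E _.
rewrite -natrD ler_nat; have := ABC E; case: (A E) => // /(_ isT).
by case: (B E); case: (C E).
Qed.

Lemma gnp_prob_ge_cover A B : (forall E, A E || B E) ->
  1 - gnp_prob p B <= gnp_prob p A.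
Proof.
move=> AB; rewrite lerBlDr.
rewrite -(bernsum_cst (upair n) 1 pq) !gnp_probE -bernsumD.
apply: ler_bernsum => // E _.
by rewrite -natrD ler1n; have := AB E; case: (A E); case: (B E).
Qed.

Lemma gnp_prob_bigU (I : finType) (Q : pred I) (B : I -> pred {set 'I_n * 'I_n}) A :
  (forall E : {set 'I_n * 'I_n}, E \subset upair n -> A E -> exists2 i, Q i & B i E) ->
  gnp_prob p A <= \sum_(i | Q i) gnp_prob p (B i).
Proof.
move=> AB; rewrite gnp_probE.
under eq_bigr => i _ do rewrite gnp_probE.
rewrite -bernsum_sum; apply: ler_bernsum => // E ED.
have [/(AB E ED)[i Qi BE]|_] := boolP (A E); last exact: sumr_ge0.
by rewrite (bigD1 i) //= BE lerDl sumr_ge0.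
Qed.

(** The variance bound is used twice. The deficit vanishes when [chi E <= a], which is likely enough
    to force its mean below [z / 2]; exceeding [z] is then a deviation of more than [z / 2]. *)
Lemma deficit_tail a (z : R) : (0 < n)%N -> 0 < z ->
  4 * n%:R / z ^+ 2 < gnp_prob p (fun E : {set 'I_n * 'I_n} => (chi E <= a)%N) ->
  gnp_prob p (fun E : {set 'I_n * 'I_n} => z < (deficit a E)%:R) <= 4 * n%:R / z ^+ 2.
Proof.
move=> n0 z0; set delta := 4 * n%:R / z ^+ 2 => Pa.
pose Y (E : {set 'I_n * 'I_n}) : R := (deficit a E)%:R.
pose mu := bernsum p (1 - p) (upair n) Y.
have z20 : 0 < z ^+ 2 by rewrite exprn_gt0.
have var : bernsum p (1 - p) (upair n) (fun E => (Y E - mu) ^+ 2) <= n%:R.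
  rewrite bernsum_sqrB // subrr expr0n addr0 upair_backstar.
  rewrite -[in leRHS](size_enum_ord n).
  apply: bernvar_lipschitz => //; first exact: enum_uniq.
  - move=> i j _ _ ij; rewrite -setI_eq0; apply/eqP/setP => e; rewrite !inE.
    by apply/negP => /andP[/andP[_ /eqP ei] /andP[_ /eqP ej]]; rewrite -ei ej eqxx in ij.
  - move=> i _ E E' eqE; rewrite ler_norml; apply/andP; split.
      by rewrite lerBrDr addrC lerBlDr natr1 ler_nat; apply: deficit_leD1 eqE.
    by rewrite lerBlDr addrC natr1 ler_nat; apply: deficit_leD1 (esym eqE).
have mu0 : 0 <= mu.
  by rewrite -(bernsum_cst (upair n) 0 pq); apply: ler_bernsum.
have mu_le : mu <= z / 2.
  have : delta * mu ^+ 2 <= n%:R.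
    apply: le_trans var.
    apply: le_trans
      (_ : gnp_prob p (fun E : {set 'I_n * 'I_n} => (chi E <= a)%N) * mu ^+ 2 <= _).
      by rewrite ler_wpM2r ?sqr_ge0 // ltW.
    rewrite gnp_probE mulrC -bernsumZ; apply: ler_bernsum => // E _.
    case: (boolP (chi E <= a)%N) => [/chi_leP Ea|_]; last by rewrite mulr0 sqr_ge0.
    suff -> : Y E = 0 by rewrite sub0r sqrrN mulr1.
    apply/eqP; rewrite pnatr_eq0 -leqn0 -(cards0 'I_n).
    by have [_] := deficitP a E; apply; rewrite setC0.
  move=> H; have n0' : 0 < n%:R :> R by rewrite ltr0n.
  have : 4 * mu ^+ 2 <= z ^+ 2.
    rewrite -(ler_pM2l n0') -[leRHS](mulrC) -ler_pdivrMl //.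
    by apply: le_trans H; rewrite /delta le_eqVlt; apply/orP; left; apply/eqP; ring.
  move=> H4; rewrite leNgt; apply/negP => lt; nra.
have : bernsum p (1 - p) (upair n) (fun E => (z / 2) ^+ 2 * (z < Y E)%R%:R) <= n%:R.
  apply: le_trans var; apply: ler_bernsum => // E _.
  have [zY|_] := ltP z (Y E); last by rewrite mulr0 sqr_ge0.
  by rewrite mulr1; nra.
rewrite bernsumZ -gnp_probE => H.
rewrite ler_pdivlMr // mulrC; move: H; rewrite exprMn exprVn; lra.
Qed.

(* The least [a] with P(chi <= a) > 4 / omega^2: Chebyshev leaves at most
   omega sqrt n vertices to delete before the graph becomes a-colourable. *)
Lemma chi_concentration (omega : R) k : (0 < n)%N -> 2 < omega ->
  let z := omega * Num.sqrt (n%:R : R) in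
  exists a : nat,
    1 - 8 / omega ^+ 2 -
      gnp_prob p (fun E : {set 'I_n * 'I_n} =>
        `[< exists2 W : {set 'I_n}, #|W|%:R <= z & ~ proper_on E W k >])
    <= gnp_prob p (fun E : {set 'I_n * 'I_n} => (a <= chi E <= a + k)%N).
Proof.
move=> n0 om2 z; set bad := gnp_prob p _.
have sn0 : 0 < Num.sqrt (n%:R : R) by rewrite sqrtr_gt0 ltr0n.
have z0 : 0 < z by apply: mulr_gt0 => //; lra.
have deltaE : 4 * n%:R / z ^+ 2 = 4 / omega ^+ 2.
  rewrite exprMn sqr_sqrtr ?ler0n //; field.
  by rewrite pnatr_eq0 -lt0n n0 andbT; apply: lt0r_neq0; lra.
have om4 : 4 < omega ^+ 2 by nra.
have ex_a : exists a, 4 / omega ^+ 2 < gnp_prob p (fun E : {set 'I_n * 'I_n} => (chi E <= a)%N).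
  exists n; apply: lt_le_trans (_ : 1 <= _); first by rewrite ltr_pdivrMr; lra.
  have cov (E : {set 'I_n * 'I_n}) : (chi E <= n)%N || pred0 E.
    rewrite orbF; apply/chi_leP; exists val.
    by split=> [i _|i j _ _]; rewrite ?ltn_ord // -val_eqE.
  apply: le_trans (gnp_prob_ge_cover cov).
  by rewrite gnp_probE (bernsum_cst _ _ pq) subr0.
pose a := ex_minn ex_a; exists a.
have [Pa amin] : 4 / omega ^+ 2 < gnp_prob p (fun E : {set 'I_n * 'I_n} => (chi E <= a)%N) /\
    gnp_prob p (fun E : {set 'I_n * 'I_n} => (chi E < a)%N) <= 4 / omega ^+ 2.
  (* For [a = 0] the event [chi E < a] is empty; otherwise minimality of [a] is applied to its
     predecessor. *)
  rewrite /a; case: ex_minnP => [[|b] Pb bmin]; split=> //.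
    by rewrite gnp_probE (bernsum_cst _ _ pq) divr_ge0 //; lra.
  by rewrite leNgt; apply/negP => /(bmin b); rewrite ltnn.
have tail := deficit_tail n0 z0; rewrite deltaE in tail.
have {}tail := tail _ Pa.
have -> : 1 - 8 / omega ^+ 2 - bad = 1 - (4 / omega ^+ 2 + (4 / omega ^+ 2 + bad)) by lra.
have cov (E : {set 'I_n * 'I_n}) :
  (a <= chi E <= a + k)%N || ~~ (a <= chi E <= a + k)%N by rewrite orbN.
apply: le_trans (gnp_prob_ge_cover cov).
rewrite lerD2l lerN2.
(* Outside the interval, either [chi E < a], or the deficit exceeds [z], or a smallest deleted set
   has at most [z] vertices and is not [k]-colourable, as otherwise [a + k] colours would
   suffice. *)
apply: le_trans (gnp_prob_leU (B := fun E => (chi E < a)%N)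
  (C := fun E => (z < (deficit a E)%:R) ||
    `[< exists2 W : {set 'I_n}, #|W|%:R <= z & ~ proper_on E W k >]) _) _.
  move=> E; rewrite negb_and -ltnNge => /orP[->//|nle]; apply/orP; right.
  case: ltP => //= dz; apply/asboolP.
  have [[W Wa Wd] _] := deficitP a E; exists W; first by rewrite Wd.
  move=> Wk; move/negP: nle; apply; apply/chi_leP.
  by rewrite -(setUCr W) setUC; apply: proper_onU.
by apply: lerD => //; apply: le_trans (gnp_prob_leU _) _; [move=> E; exact|apply: lerD].
Qed.

End RandomGraph.

(** * Degeneracy and sparsity of small vertex sets *)

Section LocalDensity.
Variables (R : realType) (n : nat).
Implicit Types (E : {set 'I_n * 'I_n}) (S W U I : {set 'I_n}).

Definition neighbors E S v : {set 'I_n} := [set w in S | (w != v) && adj E v w].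

Lemma degenerate_proper E D (small : pred nat) :
  {homo small : k l / (l <= k)%N >-> k -> l} ->
  (forall S, S != set0 -> small #|S| -> exists2 v, v \in S & (#|neighbors E S v| < D)%N) ->
  forall W, small #|W| -> proper_on E W D.
Proof.
move=> mono deg W; have [k] := ubnP #|W|; elim: k W => // k IH W leW sW.
have [->|W0] := eqVneq W set0; first exact: proper_on0.
have [v vW degv] := deg W W0 sW.
have cW : #|W| = #|W :\ v|.+1 by rewrite (cardsD1 v W) vW.
have [||f [fD fE]] := IH (W :\ v); first by rewrite -ltnS -cW.
  by apply: mono sW; rewrite cW.
pose used := [seq f w | w <- enum (neighbors E W v)].
(* Fewer than [D] colours occur around [v], so one of the [D] colours is free. *)
have [c cD cN] : exists2 c, (c < D)%N & c \notin used.
  have /allPn[c] : ~~ all (mem used) (iota 0 D).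
    apply/negP => /allP sub; have := uniq_leq_size (iota_uniq 0 D) sub.
    by rewrite size_iota size_map -cardE leqNgt degv.
  by rewrite mem_iota add0n /= => cD cN; exists c.
have fc w : w \in W -> w != v -> adj E v w -> f w != c.
  move=> wW wv vw; apply: contraNneq cN => <-; apply: map_f.
  by rewrite mem_enum inE wW wv vw.
exists (fun w => if w == v then c else f w); split=> [w wW|w x wW xW wx Ewx].
  by case: ifP => // /negbT wv; apply: fD; rewrite !inE wv.
case: ifP => [/eqP wv|/negbT wv]; case: ifP => [/eqP xv|/negbT xv].
- by rewrite wv xv eqxx in wx.
- by rewrite eq_sym fc // -wv.
- by rewrite fc // adjC -xv.
- by apply: fE => //; rewrite !inE ?wv ?xv.
Qed.

Definition inner_pairs S : {set 'I_n * 'I_n} := upair n :&: setX S S.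

Lemma sum_fiber_card (T : finType) (A : {set T}) S (g : T -> 'I_n) :
  {in A, forall e, g e \in S} -> (\sum_(v in S) #|[set e in A | g e == v]| = #|A|)%N.
Proof.
move=> gS; rewrite -[RHS]sum1_card (partition_big g (mem S)) //=.
by apply: eq_bigr => v _; rewrite -sum1_card; apply: eq_bigl => e; rewrite !inE.
Qed.

Lemma min_degree_edges E S t : E \subset upair n ->
  (forall v, v \in S -> (t.*2 <= #|neighbors E S v|)%N) ->
  (t * #|S| <= #|E :&: inner_pairs S|)%N.
Proof.
move=> ED deg; set ES := E :&: inner_pairs S.
have degle v : v \in S -> (#|neighbors E S v| <=
    #|[set e in ES | e.1 == v]| + #|[set e in ES | e.2 == v]|)%N.
  move=> vS; apply: leq_trans (_ : #|[set e.2 | e in [set e in ES | e.1 == v]] :|: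
      [set e.1 | e in [set e in ES | e.2 == v]]| <= _)%N.
    apply: subset_leq_card; apply/fintype.subsetP => w.
    rewrite inE => /and3P[wS wv /orP[Evw|Ewv]]; rewrite inE; apply/orP; [left|right].
      apply/imsetP; exists (v, w) => //.
      by have := fintype.subsetP ED _ Evw; rewrite !inE Evw vS wS /= eqxx !andbT.
    apply/imsetP; exists (w, v) => //.
    by have := fintype.subsetP ED _ Ewv; rewrite !inE Ewv vS wS /= eqxx !andbT.
  by apply: leq_trans (leq_card_setU _ _) _; apply: leq_add; apply: leq_imset_card.
have mem1 e : e \in ES -> e.1 \in S by rewrite !inE => /and3P[_ _ /andP[]].
have mem2 e : e \in ES -> e.2 \in S by rewrite !inE => /and3P[_ _ /andP[]].
rewrite -leq_double -(addnn #|ES|) -{1}(sum_fiber_card mem1) -(sum_fiber_card mem2).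
rewrite -big_split /= doubleMl mulnC -sum_nat_const; apply: leq_sum => v vS.
exact: leq_trans (deg v vS) (degle v vS).
Qed.

Variable p : R.
Hypothesis p01 : 0 < p <= 1.
Let p0 : 0 < p. Proof. by case/andP: p01. Qed.
Let q0 : 0 <= 1 - p. Proof. by rewrite subr_ge0; case/andP: p01. Qed.
Let pq : p + (1 - p) = 1. Proof. by rewrite addrC subrK. Qed.
Let p01' : 0 <= p <= 1. Proof. by case/andP: p01 => /ltW -> ->. Qed.

(* Exponential moment bound; [x] is optimised in [gnp_locally_sparse]. *)
Lemma gnp_edges_tail (F : {set 'I_n * 'I_n}) (k N : nat) (x : R) :
  F \subset upair n -> 1 <= x -> (#|F| <= N)%N ->
  gnp_prob p (fun E => (k <= #|E :&: F|)%N) <= expR (p * x * N%:R) / x ^+ k.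
Proof.
move=> FD x1 FN; have x0 : 0 < x by lra.
rewrite ler_pdivlMr ?exprn_gt0 // mulrC gnp_probE -bernsumZ.
apply: le_trans (_ : bernsum p (1 - p) (upair n) (fun E => x ^+ #|E :&: F|) <= _).
  apply: ler_bernsum => // [|E _]; first exact: ltW.
  case: leqP => [kF|_]; last by rewrite mulr0 exprn_ge0 ?ltW.
  by rewrite mulr1 ler_weXn2l.
rewrite (bernsum_restrict (fun A => x ^+ #|A|)) // bernsum_exp.
apply: le_trans (_ : expR (p * x) ^+ #|F| <= _).
  rewrite lerXn2r ?nnegrE ?expR_ge0 //; first by apply: addr_ge0 => //; apply: mulr_ge0; exact: ltW.
  by apply: le_trans (expR_ge1Dx _); rewrite lerD2r gerBl ltW.
by rewrite -expRM_natl ler_expR mulrC ler_wpM2l ?mulr_ge0 ?ler_nat ?ltW.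
Qed.

Lemma card_inner_pairs S : (#|inner_pairs S| <= #|S| ^ 2)%N.
Proof. by apply: leq_trans (subset_leq_card (subsetIr _ _)) _; rewrite cardsX. Qed.

Lemma sum_expr_card_nonempty (w : R) :
  \sum_(S : {set 'I_n} | S != set0) w ^+ #|S| = (1 + w) ^+ n - 1.
Proof.
have := bernsum_exp w 1 1 [set: 'I_n]; rewrite mulr1 cardsT card_ord => <-.
rewrite /bernsum [in RHS](bigD1 set0) ?sub0set //= cards0 expr0 !expr1n !mul1r.
rewrite addrC addrK; apply: eq_big => [S|S _]; first by rewrite subsetT.
by rewrite !expr1n !mulr1.
Qed.

Lemma expr1D_le (w : R) : 0 <= w -> n%:R * w <= 1 / 2 -> (1 + w) ^+ n - 1 <= 2 * (n%:R * w).
Proof.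
move=> w0; set x := n%:R * w => x2; have x0 : 0 <= x by rewrite mulr_ge0.
have : (1 + w) ^+ n <= expR x.
  by rewrite expRM_natl lerXn2r ?nnegrE ?expR_ge0 ?expR_ge1Dx ?addr_ge0.
have e0 := expR_gt0 x; have := expR_ge1Dx (- x); rewrite expRN => H1 H2.
(* From exp(-x) >= 1 - x, exp(x) is at most 1 / (1 - x), which is at most 1 + 2x for 0 <= x <=
   1/2. *)
suff : expR x <= 1 + 2 * x by lra.
have : expR x * (1 - x) <= 1 by rewrite -[leRHS](mulfV (lt0r_neq0 e0)) ler_pM2l.
nra.
Qed.

(** By degeneracy, failure yields a nonempty [S] of at most [r] vertices with all inner degrees at
    least [t.*2], hence with at least [t * #|S|] inner edges. This has probability at most
    [w ^+ #|S|], and the sum over all nonempty [S] is (1 + w)^n - 1. *)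
Lemma gnp_locally_sparse (r : R) (t : nat) : (0 < n)%N -> (0 < t)%N -> 0 < r ->
  let w := (expR 1 * p * r / t%:R) ^+ t in
  n%:R * w <= 1 / 2 ->
  gnp_prob p (fun E => `[< exists2 W : {set 'I_n}, #|W|%:R <= r & ~ proper_on E W t.*2 >])
    <= 2 * (n%:R * w).
Proof.
move=> n0 t0 r0; set y := expR 1 * p * r / t%:R => w nw.
have t0' : 0 < t%:R :> R by rewrite ltr0n.
have y0 : 0 <= y by rewrite divr_ge0 ?mulr_ge0 ?expR_ge0 ?ltW.
have w0 : 0 <= w by rewrite exprn_ge0.
have y1 : y <= 1.
  rewrite leNgt; apply/negP => y1.
  have : 1 <= w by rewrite exprn_ege1 // ltW.
  have : 1 <= n%:R :> R by rewrite ler1n.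
  nra.
apply: le_trans (expr1D_le w0 nw); rewrite -sum_expr_card_nonempty.
apply: le_trans (_ : \sum_(S : {set 'I_n} | (S != set0) && (#|S|%:R <= r))
   gnp_prob p (fun E => (t * #|S| <= #|E :&: inner_pairs S|)%N) <= _).
  apply: gnp_prob_bigU => // E ED /asboolP[W Wr nW].
  apply: contrapT => none; apply: nW.
  apply: (@degenerate_proper E t.*2 (fun k => k%:R <= r)) => // [k l lk /= kr|S S0 Sr].
    by apply: le_trans kr; rewrite ler_nat.
  apply: contrapT => nv; apply: none; exists S; first by rewrite S0.
  apply: min_degree_edges => // v vS; rewrite leqNgt; apply/negP => lt.
  by apply: nv; exists v.
rewrite [leRHS](bigID (fun S : {set 'I_n} => #|S|%:R <= r)) /=.
rewrite -[leLHS]addr0; apply: lerD; last by apply: sumr_ge0 => S _; rewrite exprn_ge0.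
apply: ler_sum => S /andP[S0 Sr].
have s0 : 0 < #|S|%:R :> R by rewrite ltr0n card_gt0.
(* With s the order of [S], this [x] minimises exp(p x s^2) / x^(t s); the minimum is (e / x)^(t s),
   where e / x is at most [y]. *)
pose x := t%:R / (p * #|S|%:R).
have x0 : 0 < x by rewrite divr_gt0 ?mulr_gt0.
have exy : expR 1 / x <= y.
  rewrite /x invf_div /y mulrA ler_pM2r ?invr_gt0 // mulrA ler_wpM2l //.
  by rewrite mulr_ge0 ?expR_ge0 ?ltW.
have x1 : 1 <= x.
  have : expR 1 / x <= 1 by apply: le_trans y1.
  rewrite ler_pdivrMr // mul1r; apply: le_trans.
  by have := expR_ge1Dx (1 : R); lra.
apply: le_trans (gnp_edges_tail _ (subsetIl _ _) x1 (card_inner_pairs S)) _.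
have -> : p * x * (#|S| ^ 2)%:R = (t * #|S|)%:R * 1.
  by rewrite /x natrX natrM; field; rewrite ?lt0r_neq0.
rewrite expRM_natl -expr_div_n /w -exprM.
by apply: lerXn2r; rewrite ?nnegrE // divr_ge0 ?expR_ge0 // ltW.
Qed.

End LocalDensity.

(** * Greedy removal of independent sets *)

Section GreedyPeeling.
Variable n : nat.
Implicit Types (E : {set 'I_n * 'I_n}) (S W U I : {set 'I_n}).

Lemma maximal_independent E W : exists I, [/\ I \subset W, independent E I &
  forall v, v \in W :\: I -> exists2 w, w \in I & adj E v w].
Proof.
pose P := fun I : {set 'I_n} => (I \subset W) && independent E I.
have [|I /maxsetP[/andP[IW indI] Imax]] := @ex_maxset _ P.
  by exists set0; rewrite /P sub0set; apply/independentP => i j; rewrite inE.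
exists I; split=> // v; rewrite inE => /andP[vI vW]; apply: contrapT => none.
have noadj w : w \in I -> ~~ adj E v w.
  by move=> wI; apply/negP => vw; apply: none; exists w.
have : P (v |: I).
  rewrite /P subUset sub1set vW IW /=; apply/independentP => i j.
  rewrite !inE => /predU1P[->|iI] /predU1P[->|jI]; rewrite ?eqxx // => ij.
  - exact: noadj.
  - by rewrite adjC noadj.
  - by move/independentP: indI; apply.
by move=> /Imax/(_ (subsetUr _ _)) eqI; move: vI; rewrite -eqI setU11.
Qed.

(* [c v] is the round in which [v] is removed, and [m] if [v] survives [m] rounds. *)
Lemma greedy_peeling E U K m :
  (forall I, I \subset U -> independent E I -> (#|I| <= K)%N) ->
  exists c : 'I_n -> nat,
    [/\ forall v, (c v <= m)%N,
        forall j, (j < m)%N -> (#|[set v in U | c v == j]| <= K)%N,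
        (#|U| <= #|[set v in U | c v == m]| + m * K)%N &
        forall v, v \in U -> c v = m -> forall j, (j < m)%N ->
          exists w, [/\ w \in U, c w = j & adj E v w]].
Proof.
move=> indK; elim: m => [|m [c [cm cK cU cdom]]].
  exists (fun=> 0%N); split=> //.
  by rewrite mul0n addn0; apply: subset_leq_card; apply/fintype.subsetP => v vU; rewrite inE vU.
pose S := [set v in U | c v == m].
have [I [IS indI Idom]] := maximal_independent E S.
have SU : S \subset U by apply/fintype.subsetP => v; rewrite inE => /andP[].
have IK : (#|I| <= K)%N by apply: indK => //; apply: fintype.subset_trans IS SU.
(* The set [I] keeps the label [m] and so becomes the class of round [m]; the other survivors move
   on to [m.+1]. *)
pose c' v := if v \in S :\: I then m.+1 else c v.
have c'S v : v \in U -> (c' v == m.+1) = (v \in S :\: I).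
  by rewrite /c'; case: ifP => [|_] vU; rewrite ?eqxx // ltn_eqF // ltnS cm.
exists c'; split.
- by move=> v; rewrite /c'; case: ifP => // _; rewrite leqW.
- move=> j; rewrite ltnS leq_eqVlt => /predU1P[->|jm].
    apply: leq_trans IK; apply: subset_leq_card; apply/fintype.subsetP => v.
    rewrite inE /c' => /andP[vU]; case: ifP => [_|]; first by rewrite gtn_eqF.
    by rewrite !inE vU => + cv; rewrite cv /= andbT => /negbT; rewrite negbK.
  apply: leq_trans (cK j jm); apply: subset_leq_card; apply/fintype.subsetP => v.
  rewrite !inE /c' => /andP[->]; case: ifP => // _ /eqP mj.
  by move: jm; rewrite -mj ltnNge leqnSn.
- have -> : [set v in U | c' v == m.+1] = S :\: I.
    apply/setP => v; rewrite inE; case: (boolP (v \in U)) => [/c'S->//|vU] /=.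
    by rewrite !inE (negbTE vU) andbF.
  rewrite cardsD (setIidPr IS) mulSn; have := subset_leq_card IS.
  by move: cU; rewrite -/S; move: IK; lia.
- move=> v vU /eqP; rewrite c'S // => vSI j; rewrite ltnS leq_eqVlt => /predU1P[->|jm].
    have [w wI vw] := Idom v vSI; exists w.
    have wS := fintype.subsetP IS w wI; split=> //; first exact: (fintype.subsetP SU).
    by rewrite /c' inE wI /=; move: wS; rewrite inE => /andP[_ /eqP].
  have cv : c v = m by move: vSI; rewrite !inE => /and3P[_ _ /eqP].
  have [w [wU cw vw]] := cdom v vU cv j jm; exists w; split=> //.
  by rewrite /c' !inE cw (ltn_eqF jm) !andbF.
Qed.

(** While at least [u] vertices are left, some [u] of them contain an independent set of more than
    [K] vertices, which gets a colour of its own. After at most [b] rounds fewer than [u] vertices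
    remain, and [k] colours suffice for them. *)
Lemma proper_on_peel E u K k b W :
  (forall S, (#|S| < u)%N -> proper_on E S k) ->
  (forall U, #|U| = u -> exists I, [/\ I \subset U, independent E I & (K < #|I|)%N]) ->
  (#|W| < u + b * K)%N -> proper_on E W (b + k).
Proof.
move=> small big; elim: b W => [|b IH] W; first by rewrite mul0n addn0; apply: small.
have [Wu _|uW cW] := ltnP #|W| u.
  have [f [fk fE]] := small W Wu; exists f; split=> // v vW.
  by apply: leq_trans (fk v vW) _; rewrite leq_addl.
have [U UW cU] : exists2 U : {set 'I_n}, U \subset W & #|U| = u.
  exists [set v in take u (enum W)].
    by apply/fintype.subsetP => v; rewrite inE => /mem_take; rewrite mem_enum.
  rewrite cardsE; have /card_uniqP -> : uniq (take u (enum W)).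
    by rewrite take_uniq // enum_uniq.
  by rewrite size_takel // -cardE.
have [I [IU indI KI]] := big U cU.
have IW : I \subset W by apply: fintype.subset_trans IU UW.
have -> : W = I :|: (W :\: I) by rewrite -{1}(setID W I) (setIidPr IW).
rewrite addSn -[(b + k).+1]add1n; apply: proper_onU; first exact: proper_on_independent.
apply: IH; rewrite cardsD (setIidPr IW).
have := subset_leq_card IW; move: cW; rewrite mulSn; lia.
Qed.

(** * Templates: recording a peeling for the union bound *)

Definition mkpair (v w : 'I_n) : 'I_n * 'I_n := if (v < w)%N then (v, w) else (w, v).

Lemma mkpair_upair v w : v != w -> mkpair v w \in upair n.
Proof.
rewrite -val_eqE /mkpair inE; case: (ltngtP v w) => //= _.
Qed.

Lemma mkpair_inj v w v' w' : mkpair v w = mkpair v' w' ->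
  (v = v' /\ w = w') \/ (v = w' /\ w = v').
Proof.
by rewrite /mkpair; case: ifP => _; case: ifP => _ [-> ->]; [left|right|right|left].
Qed.

Lemma adj_mkpair E v w : E \subset upair n -> adj E v w -> mkpair v w \in E.
Proof.
move=> /fintype.subsetP ED /orP[] e; have := ED _ e; rewrite inE /mkpair /= => lt.
  by rewrite lt.
by rewrite ltnNge ltnW.
Qed.

Section Template.
Variables (u m : nat).
Implicit Type g : {ffun 'I_u -> 'I_n * 'I_m.+1}.

(* [g] lists [u] vertices together with a class: the classes below [m] are the
   removed independent sets, the class [ord_max] is what is left after [m] rounds. *)
Definition template_class g (j : 'I_m.+1) : {set 'I_n} := [set v | [exists i, g i == (v, j)]].

Definition early (j : 'I_m) : 'I_m.+1 := widen_ord (leqnSn m) j.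

(** Disjoint classes make the blocks [template_edges] disjoint, [K] bounds the size of a block, and
    [h] bounds the number of survivors from below. *)
Definition template_ok K h g : bool :=
  [&& [forall j, forall j', (j != j') ==> [disjoint template_class g j & template_class g j']],
      [forall j, #|template_class g (early j)| <= K]%N &
      (h <= #|template_class g ord_max|)%N].

(** A vertex outside the class has a neighbour in it exactly when the graph meets this block. *)
Definition template_edges g (vj : 'I_n * 'I_m) : {set 'I_n * 'I_n} :=
  [set mkpair vj.1 w | w in template_class g (early vj.2)].

Definition template_pairs g : {set 'I_n * 'I_m} :=
  setX (template_class g ord_max) setT.

(** There are at least [h * m] blocks, one per survivor and removed class. A pair joining a survivor
    to a removed vertex determines both, so the blocks are disjoint and [bernsum_hit] applies. *)
Lemma template_hit (R : realType) (p : R) K h g : 0 <= p <= 1 -> template_ok K h g ->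
  gnp_prob p (fun E => [forall vj in template_pairs g, E :&: template_edges g vj != set0])
    <= (1 - (1 - p) ^+ K) ^+ (h * m).
Proof.
move=> /andP[p0 p1] /and3P[/forallP dis /forallP cK hle].
have disj j j' v : j != j' -> v \in template_class g j -> v \in template_class g j' -> False.
  move=> jj' vj vj'; have /forallP/(_ j')/implyP/(_ jj') := dis j.
  by move/disjointFr/(_ vj); rewrite vj'.
have emax j : early j != ord_max by rewrite -val_eqE /= ltn_eqF.
have q0 : 0 <= 1 - p by lra.
have q1 : 1 - p <= 1 by lra.
rewrite gnp_probE; apply: le_trans (_ : _ <= (1 - (1 - p) ^+ K) ^+ #|template_pairs g|) _.
  apply: bernsum_hit => //; first by lra.
    move=> [v j]; rewrite in_setX in_setT andbT /= => vmax; split.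
      apply/fintype.subsetP => e /imsetP[w wj ->]; apply: mkpair_upair.
      by apply/eqP => vw; apply: (disj _ _ w (emax j) wj); rewrite -vw.
    by apply: leq_trans (leq_imset_card _ _) (cK j).
  move=> [v j] [v' j'] /=; rewrite !in_setX !in_setT !andbT /= => vmax v'max ne.
  rewrite -setI_eq0; apply/eqP/setP => e; rewrite !inE.
  apply/negP => /andP[/imsetP[/= w wj ->] /imsetP[/= w' wj' /mkpair_inj[[vv ww]|[vw _]]]].
    move/negP: ne; apply; rewrite vv -pair_eqE /pair_eq /= eqxx /=.
    apply/eqP; apply: contrapT => /eqP jj; apply: (@disj (early j) (early j') w) => //.
    by rewrite ww.
  by apply: (disj _ _ v (emax j')) => //; rewrite vw.
apply: ler_wiXn2l; rewrite ?subr_ge0 ?gerBl ?exprn_ge0 ?exprn_ile1 //.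
by rewrite cardsX cardsT card_ord leq_mul2r hle orbT.
Qed.

End Template.

(** Peel [U] for [m] rounds and list its vertices with their rounds. At most [m * K] vertices are
    removed, so at least [h] survive, and each survivor has a neighbour in every removed class. *)
Lemma template_exists E U K m h : E \subset upair n -> (h + m * K <= #|U|)%N ->
  (forall I, I \subset U -> independent E I -> (#|I| <= K)%N) ->
  exists2 g : {ffun 'I_#|U| -> 'I_n * 'I_m.+1}, template_ok K h g &
    [forall vj in template_pairs g, E :&: template_edges g vj != set0].
Proof.
move=> ED hU indK; have [c [cm cK cU cdom]] := greedy_peeling m indK.
pose g := [ffun i : 'I_#|U| => (enum_val i, inord (c (enum_val i)) : 'I_m.+1)].
have clE (j : 'I_m.+1) : template_class g j = [set v in U | c v == j].
  apply/setP => v; rewrite !inE; apply/existsP/andP => [[i]|[vU /eqP cv]].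
    rewrite ffunE => /eqP[<- <-]; rewrite enum_valP; split=> //.
    by rewrite inordK // ltnS.
  exists (enum_rank_in vU v); rewrite ffunE enum_rankK_in // cv.
  by rewrite inord_val.
exists g.
  apply/and3P; split.
  - apply/forallP => j; apply/forallP => j'; apply/implyP => jj'; rewrite !clE.
    rewrite -setI_eq0; apply/eqP/setP => v; rewrite !inE.
    apply/negP => /andP[/andP[_ /eqP cj] /andP[_ /eqP cj']].
    by move/eqP: jj'; apply; apply: val_inj; rewrite /= -cj -cj'.
  - by apply/forallP => j; rewrite clE; apply: cK => /=.
  - by rewrite clE -(leq_add2r (m * K)); apply: leq_trans hU cU.
apply/forall_inP => -[v j]; rewrite in_setX in_setT andbT clE inE /= => /andP[vU /eqP cv].
have [w [wU cw vw]] := cdom v vU cv j (ltn_ord j).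
apply/set0Pn; exists (mkpair v w); rewrite inE adj_mkpair //=.
by apply: imset_f; rewrite clE inE wU cw /=.
Qed.

(** Union bound over all templates: each bad [U] provides one whose blocks are all hit. *)
Lemma gnp_large_independent (R : realType) (p : R) u K m h : 0 <= p <= 1 ->
  (h + m * K <= u)%N ->
  gnp_prob p (fun E => `[< exists2 U : {set 'I_n}, #|U| = u &
      forall I, I \subset U -> independent E I -> (#|I| <= K)%N >])
  <= ((n * m.+1) ^ u)%:R * (1 - (1 - p) ^+ K) ^+ (h * m).
Proof.
move=> p01 hu; have /andP[p0 p1] := p01.
have Bn0 : 0 <= (1 - (1 - p) ^+ K) ^+ (h * m).
  by rewrite exprn_ge0 // subr_ge0 exprn_ile1 ?subr_ge0 // gerBl.
apply: le_trans (_ : \sum_(g : {ffun 'I_u -> 'I_n * 'I_m.+1} | template_ok K h g)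
  gnp_prob p (fun E => [forall vj in template_pairs g, E :&: template_edges g vj != set0]) <= _).
  apply: gnp_prob_bigU => // E ED /asboolP[U cU indK].
  by subst u; apply: template_exists.
apply: le_trans (_ : \sum_(g : {ffun 'I_u -> 'I_n * 'I_m.+1}) (1 - (1 - p) ^+ K) ^+ (h * m) <= _).
  rewrite big_mkcond /=; apply: ler_sum => g _; case: ifP => // gok.
  exact: template_hit.
by rewrite sumr_const card_ffun card_prod !card_ord mulr_natl.
Qed.

End GreedyPeeling.

(** * Numerical bounds and the range zp << log n *)

Lemma nat_above (R : realType) (x : R) : 0 <= x ->
  exists k : nat, [/\ (0 < k)%N, x < k%:R & k%:R <= x + 1].
Proof.
move=> x0; exists (Num.truncn x).+1; split=> //; first exact: truncnS_gt.
by rewrite -natr1 lerD2r truncn_le.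
Qed.

Section Regimes.
Variables (R : realType) (n : nat) (p omega : R).
Hypotheses (p01 : 0 < p < 1) (l1 : 1 <= ln (n%:R : R)) (om2 : 2 < omega).

Let z := omega * Num.sqrt (n%:R : R).

Lemma expR1_le4 : expR 1 <= 4 :> R.
Proof.
have -> : 1 = 2%:R * (1 / 2) :> R by lra.
rewrite expRM_natl; have := expR_ge1Dx (- (1 / 2) : R); rewrite expRN => H.
have e0 := expR_gt0 (1 / 2 : R).
have : expR (1 / 2) * (1 + - (1 / 2)) <= 1 :> R.
  by rewrite -[leRHS](mulfV (lt0r_neq0 e0)) ler_pM2l.
by move: e0; set x := expR _; nra.
Qed.

Lemma ge2_of_ln_nat : (2 <= n)%N.
Proof.
by case: n l1 => [|[|m]] //; [rewrite ln0 // ler10 | rewrite ln1 ler10].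
Qed.

Lemma expR_lnn : expR (ln (n%:R : R)) = n%:R.
Proof. by rewrite lnK // posrE ltr0n (leq_trans _ ge2_of_ln_nat). Qed.

Lemma le_ln_natr : ln (n%:R : R) <= n%:R.
Proof. by rewrite -[leRHS]expR_lnn; have := expR_ge1Dx (ln (n%:R : R)); lra. Qed.

Lemma sqrt_scale_ge2 : 2 <= z.
Proof.
have s1 : 1 <= Num.sqrt (n%:R : R).
  have n1 : (0 < n)%N by apply: leq_trans ge2_of_ln_nat.
  by rewrite -[leLHS]sqrtr1 ler_sqrt ?ltr0n ?ler1n.
by have om2' := om2; rewrite /z; nra.
Qed.

Lemma chi_interval (k : nat) (L : R) : k%:R <= L ->
  gnp_prob p (fun E : {set 'I_n * 'I_n} =>
        `[< exists2 W : {set 'I_n}, #|W|%:R <= z & ~ proper_on E W k >])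
    <= 2 / n%:R ->
  exists a : R, 1 - 8 / omega ^+ 2 - 2 / n%:R <=
    gnp_prob p (fun E : {set 'I_n * 'I_n} => (a <= (chi E)%:R) && ((chi E)%:R <= a + L)).
Proof.
move=> kL bad; have p01' : 0 <= p <= 1 by case/andP: p01 => /ltW-> /ltW->.
have [|a Pa] := @chi_concentration R n p p01' omega k _ om2.
  exact: leq_trans ge2_of_ln_nat.
exists a%:R; apply: le_trans (le_trans Pa _); first by rewrite lerD2l lerN2.
apply: gnp_prob_le => // E /andP[ac cak]; rewrite ler_nat ac /=.
by apply: le_trans (_ : (a + k)%:R <= _); rewrite ?ler_nat // natrD lerD2l.
Qed.

(** Bernoulli's inequality for (1 - p)^N with N at most n^2. It settles extremely small [p]. *)
Lemma gnp_empty : 1 - n%:R ^+ 2 * p <= gnp_prob p (fun E : {set 'I_n * 'I_n} => E == set0).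
Proof.
have [p0 p1] := andP p01.
rewrite gnp_probE bernsum_eq0; apply: le_trans (_ : 1 - #|upair n|%:R * p <= _).
  by rewrite lerD2l lerN2 ler_wpM2r -?natrX ?ler_nat ?card_upair ?ltW.
elim: #|upair n| => [|m IH]; first by rewrite mul0r subr0 expr0.
rewrite exprS -natr1; have m0 : 0 <= m%:R :> R by [].
apply: le_trans (_ : (1 - p) * (1 - m%:R * p) <= _); first by nra.
by rewrite ler_wpM2l // subr_ge0 ltW.
Qed.

Lemma chi_empty : (0 < n)%N -> chi (set0 : {set 'I_n * 'I_n}) = 1%N.
Proof.
move=> n0; apply/eqP; rewrite eqn_leq; apply/andP; split.
  by apply/chi_leP; exists (fun=> 0%N); split=> // i j _ _ _; rewrite /adj !inE.
rewrite ltnNge; apply/negP => /chi_leP[f [f0 _]].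
by have := f0 (Ordinal n0); rewrite inE ltn0 => /(_ isT).
Qed.

Lemma chi_interval_sparse (C : R) : 24 <= C -> 1 < ln (n%:R : R) / (z * p) ->
  exists a : R, 1 - 8 / omega ^+ 2 - 2 / n%:R <=
    gnp_prob p (fun E : {set 'I_n * 'I_n} => (a <= (chi E)%:R) &&
      ((chi E)%:R <= a + C * ln (n%:R : R) / ln (ln (n%:R : R) / (z * p)))).
Proof.
move=> C24 d1; have [p0 p1] := andP p01; have z2 := sqrt_scale_ge2; have n2 := ge2_of_ln_nat.
have n2' : 2 <= n%:R :> R by rewrite ler_nat.
have n0 : 0 < n%:R :> R by lra.
set l := ln (n%:R : R) in d1 *; set d := l / (z * p) in d1 *; set de := ln d.
have l0 : 0 < l by apply: lt_le_trans l1.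
have z0 : 0 < z by lra.
have de0 : 0 < de by rewrite ln_gt0.
have dE : expR de = d by rewrite lnK // posrE; lra.
have lE : l = z * p * expR de by rewrite dE /d; field; rewrite !lt0r_neq0.
have nE : expR l = n%:R := expR_lnn.
(* In the first case [l / de] is at least 1/4, so rounding [8 * x] up to [t] still leaves [t.*2] at
   most [24 * x]: hence the constant 24. In the second case [p] is so small that the graph is almost
   surely empty in the limit. *)
have [dl|dl] := leP de (4 * l).
  pose x := l / de; have x4 : 1 / 4 <= x by rewrite /x ler_pdivlMr //; lra.
  have x0 : 0 <= 8 * x by lra.
  have [t [t00 tgt tle]] := nat_above x0.
  have t0 : 0 < t%:R :> R by lra.
  apply: (@chi_interval t.*2).
    by rewrite -muln2 natrM -mulrA -/x; nra.
  (* Since [t] exceeds [8 * l / de], the base is at most exp(-de / 2), and its power at most exp(-4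
     l). *)
  have w2 : (expR 1 * p * z / t%:R) ^+ t <= expR (- (2 * l)).
    apply: le_trans (_ : expR (- (de / 2)) ^+ t <= _).
      apply: lerXn2r; rewrite ?nnegrE ?expR_ge0 //.
        by apply/ltW/divr_gt0 => //; do 2?[apply: mulr_gt0 => //]; exact: expR_gt0.
      rewrite ler_pdivrMr // expRN -ler_pdivrMl ?invr_gt0 ?expR_gt0 // invrK.
      have : expR (de / 2) * expR (de / 2) = expR de by rewrite -expRD; congr expR; lra.
      have := expR_ge1Dx (de / 2); have e4 := expR1_le4; have e0 := expR_gt0 (1 : R).
      set s := expR (de / 2) => s1 sE.
      have xd : x * de = l by rewrite /x divfK // lt0r_neq0.
      rewrite -sE in lE.
      have pz0 : 0 < p * z by rewrite mulr_gt0.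
      apply: le_trans (ltW tgt); apply: le_trans (_ : 4 * (p * z) * s <= _).
        have s0 : 0 <= p * z * s by apply: mulr_ge0; [exact: ltW|exact: expR_ge0].
        have : 0 <= (4 - expR 1) * (p * z * s) by rewrite mulr_ge0 // subr_ge0.
        by move: (z) => z'; lra.
      by rewrite -(ler_pM2r de0) -(mulrA 8) xd lE; nra.
    rewrite -expRM_natl ler_expR.
    have : 8 * x * de = 8 * l by rewrite /x -mulrA divfK // lt0r_neq0.
    by nra.
  have nw : n%:R * (expR 1 * p * z / t%:R) ^+ t <= n%:R^-1.
    apply: le_trans (_ : n%:R * expR (- (2 * l)) <= _); first by rewrite ler_pM2l.
    have -> : - (2 * l) = - l + - l by rewrite mulr_natl mulr2n opprD.
    by rewrite expRD !expRN nE mulrA mulfV ?mul1r // lt0r_neq0.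
  have nV : n%:R^-1 <= 1 / 2 :> R by rewrite -div1r ler_pdivrMr //; lra.
  have p01' : 0 < p <= 1 by rewrite p0 ltW.
  have := gnp_locally_sparse p01' (leq_trans _ n2) t00 z0 (le_trans nw nV).
  move=> /(_ isT)/le_trans; apply.
  by rewrite ler_pM2l.
(* Here d > n^4, so n^4 p <= n^4 z p <= log n <= n and n^2 p <= 1/n; on the empty graph [chi] is
   1. *)
exists 1; apply: le_trans (_ : 1 - n%:R ^+ 2 * p <= _).
  have : n%:R ^+ 2 * p <= 1 / n%:R.
    rewrite ler_pdivlMr //.
    have : expR (4%:R * l) <= expR de by rewrite ler_expR ltW.
    rewrite expRM_natl nE => n4; have := le_ln_natr; rewrite -/l lE => ln_le.
    have z1 : 1 <= z by lra.
    have D1 : p * n%:R ^+ 4 <= n%:R.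
      apply: le_trans ln_le; rewrite -mulrA -[leLHS]mul1r.
      apply: ler_pM => //; last by rewrite ler_pM2l.
      by apply: mulr_ge0; [exact: ltW|apply: exprn_ge0].
    by rewrite -(ler_pM2r n0) mul1r; apply: le_trans D1; rewrite le_eqVlt; apply/orP; left;
      apply/eqP; ring.
  have : 0 <= 8 / omega ^+ 2 by rewrite divr_ge0 // sqr_ge0.
  have : 0 < n%:R^-1 :> R by rewrite invr_gt0.
  lra.
apply: le_trans gnp_empty _; apply: gnp_prob_le; first by rewrite !ltW.
move=> E /eqP->; rewrite chi_empty ?lexx ?(leq_trans _ n2) //= lerDl.
by rewrite divr_ge0 ?mulr_ge0 ?ltW //; lra.
Qed.

End Regimes.

(** * The range zp >> log n *)

Lemma expr1B_ge_expR (R : realType) (p gamma : R) (K : nat) : 0 < p <= gamma -> gamma < 1 ->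
  expR (- (K%:R * p / (1 - gamma))) <= (1 - p) ^+ K.
Proof.
move=> /andP[p0 pg] g1; have q0 : 0 < 1 - p by lra.
rewrite -mulrA -mulrN expRM_natl; apply: lerXn2r; rewrite ?nnegrE ?expR_ge0 //; first exact: ltW.
(* After inversion, the claim for one factor is 1 / (1 - p) = 1 + p / (1 - p) <= exp(p / (1 -
   gamma)). *)
rewrite expRN -[leRHS]invrK lef_pV2 ?posrE ?expR_gt0 ?invr_gt0 //.
apply: le_trans (expR_ge1Dx _); apply: le_trans (_ : 1 + p / (1 - p) <= _).
  by rewrite le_eqVlt; apply/orP; left; apply/eqP; field; rewrite lt0r_neq0.
by rewrite lerD2l ler_pM2l // lef_pV2 ?posrE //; lra.
Qed.

Lemma sqr_div8_le_expR (R : realType) (x : R) : 0 <= x -> (x / 8) ^+ 2 <= expR (x / 4).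
Proof.
move=> x0; have -> : x / 4 = 2%:R * (x / 8) by lra.
rewrite expRM_natl; apply: lerXn2r; rewrite ?nnegrE ?expR_ge0 ?divr_ge0 //.
by have := expR_ge1Dx (x / 8); lra.
Qed.

(** With q = (1 - p)^K, the at most n^(2u) templates cost exp(2 u log n), while each has probability
    at most exp(-q h m) with h m >= u^2 / (8 K). The hypothesis makes q h m at least 3 u log n,
    whence 24 = 3 * 8. *)
Lemma gnp_small_independence (R : realType) (n : nat) (p : R) (u K : nat) :
  0 < p < 1 -> (2 <= n)%N -> (0 < K)%N -> (K.*2 <= u)%N ->
  24 * ln (n%:R : R) * K%:R <= u%:R * (1 - p) ^+ K ->
  gnp_prob p (fun E : {set 'I_n * 'I_n} => `[< exists2 U : {set 'I_n}, #|U| = u &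
      forall I : {set 'I_n}, I \subset U -> independent E I -> (#|I| <= K)%N >]) <= 1 / n%:R.
Proof.
move=> /andP[p0 p1] n2 K0 Ku uK; set A := fun E => _.
have n0 : 0 < n%:R :> R by rewrite ltr0n (leq_trans _ n2).
have nE : expR (ln (n%:R : R)) = n%:R by rewrite lnK.
have p01 : 0 <= p <= 1 by rewrite !ltW.
have [nu|un] := ltnP n u.
  apply: le_trans (_ : gnp_prob p (pred0 : pred {set 'I_n * 'I_n}) <= _).
    apply: gnp_prob_le => // E /asboolP[U cU _].
    by have := max_card U; rewrite cU card_ord leqNgt nu.
  by rewrite /gnp_prob big1 ?divr_ge0 ?ltW // => E; rewrite andbF.
have u0 : (0 < u)%N by apply: leq_trans Ku; rewrite double_gt0.
(* Peeling at most half of the vertices keeps both [h >= u / 2] and [m >= u / (4 K)]. *)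
pose m := (u %/ K.*2)%N; pose h := (u - m * K)%N.
have mKu : (m * K.*2 <= u)%N by apply: leq_trunc_div.
have m0 : (0 < m)%N by rewrite divn_gt0 // double_gt0.
have um : (u < m.+1 * K.*2)%N by rewrite ltn_ceil // double_gt0.
have mKh : (h + m * K <= u)%N by rewrite /h; move: mKu; rewrite -muln2; nia.
have h2 : (u <= 2 * h)%N by rewrite /h; move: mKu; rewrite -muln2; nia.
have m4 : (u <= 4 * (m * K))%N by move: um; rewrite -muln2; nia.
have m1n : (m.+1 <= n)%N by move: mKu; rewrite -muln2; nia.
apply: le_trans (gnp_large_independent n p01 mKh) _.
set q := (1 - p) ^+ K in uK *; set l := ln (n%:R : R) in uK nE *.
have q0 : 0 < q by rewrite exprn_gt0 // subr_gt0.
have q1 : q <= 1 by apply: exprn_ile1; lra.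
have l0 : 0 <= l by rewrite ln_ge0 // ler1n (leq_trans _ n2).
apply: le_trans (_ : expR (u%:R * (2%:R * l)) * expR ((h * m)%:R * - q) <= _).
  apply: ler_pM; rewrite ?exprn_ge0 ?subr_ge0 //.
    rewrite !expRM_natl nE -!natrX ler_nat leq_exp2r //.
    by rewrite -mulnn leq_mul2l m1n orbT.
  rewrite expRM_natl; apply: lerXn2r; rewrite ?nnegrE ?subr_ge0 ?expR_ge0 //.
  exact: expR_ge1Dx.
rewrite -expRD -nE div1r -expRN ler_expR.
have u1 : 1 <= u%:R :> R by rewrite ler1n.
have hR : u%:R <= 2 * h%:R :> R by rewrite -natrM ler_nat.
have mR : u%:R <= 4 * (m%:R * K%:R) :> R by rewrite -!natrM ler_nat.
have K0' : 0 < K%:R :> R by rewrite ltr0n.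
have hmq : 3 * (u%:R * l) <= (h * m)%:R * q.
  rewrite -(ler_pM2r K0') natrM.
  have uu : u%:R * u%:R <= 2 * h%:R * (4 * (m%:R * K%:R)) :> R by apply: ler_pM.
  have H1 : u%:R * u%:R * q <= 2 * h%:R * (4 * (m%:R * K%:R)) * q by rewrite ler_pM2r.
  have H2 : 24 * l * K%:R * u%:R <= u%:R * q * u%:R by rewrite ler_pM2r //; lra.
  by move: H1 H2; clear; lra.
have : l <= u%:R * l by rewrite ler_peMl.
by rewrite mulrN; lra.
Qed.

(** With d = z p / log n, take s = d^(1/4), K about ep la / p, u about z / s, t about z p / la and b
    about z / K. At most b independent sets of more than K vertices are split off; the rest, at most
    z / s vertices, is coloured with 2t colours by local sparsity. *)
Lemma gnp_small_sets_dense (R : realType) (n : nat) (p gamma z : R) :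
  let la := ln (z * p / ln (n%:R : R)) in
  0 < p <= gamma -> gamma < 1 -> 1 <= ln (n%:R : R) -> 0 < z ->
  1024 <= la -> 8 / (1 - gamma) <= la ->
  exists2 k : nat, k%:R <= (8 / (1 - gamma) + 5) * (z * p / la) &
  gnp_prob p (fun E : {set 'I_n * 'I_n} =>
    `[< exists2 W : {set 'I_n}, #|W|%:R <= z & ~ proper_on E W k >]) <= 2 / n%:R.
Proof.
move=> la pg g1 l1 z0 la1 la2; have [p0 pg'] := andP pg; have p1 : p < 1 by lra.
have n2 := ge2_of_ln_nat l1; have nE := expR_lnn l1.
have n2' : 2 <= n%:R :> R by rewrite ler_nat.
set l := ln (n%:R : R) in l1 nE la la1 la2 *.
have zp0 : 0 < z * p by rewrite mulr_gt0.
have la0 : 0 < la by lra.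
have ZE : z * p = expR la * l.
  by rewrite /la lnK ?posrE ?divr_gt0 ?divfK ?lt0r_neq0 //; lra.
pose s := expR (la / 4).
(* (la / 8)^2 >= 16 la as soon as la >= 1024. *)
have s16 : 16 * la <= s.
  by apply: le_trans (sqr_div8_le_expR (ltW la0)); nra.
have sE : s ^+ 4 = expR la by rewrite -expRM_natl; congr expR; lra.
have s1 : 1 <= s by lra.
(* Chosen so that (1 - p)^K is at least 1 / s: K p is at most 2 ep la, and division by 1 - gamma
   gives la / 4. *)
pose ep := (1 - gamma) / 8.
have ep0 : 0 < ep by rewrite /ep; lra.
have ep8 : ep <= 1 / 8 by rewrite /ep; lra.
have epla : 1 <= ep * la.
  by move: la2; rewrite ler_pdivrMr; last lra; rewrite /ep; lra.
have epE : (8 / (1 - gamma)) * ep = 1.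
  by rewrite /ep; field; rewrite subr_eq0 gt_eqF.
have xK0 : 0 <= ep * la / p by apply: divr_ge0; [lra|exact: ltW].
have [K [K0 Kgt Kle]] := nat_above xK0.
have Kp1 : ep * la <= K%:R * p by rewrite -ler_pdivrMr // ltW.
have Kp2 : K%:R * p <= 2 * (ep * la).
  have : K%:R * p <= (ep * la / p + 1) * p by rewrite ler_pM2r.
  by rewrite mulrDl divfK ?lt0r_neq0 //; lra.
have qK : s^-1 <= (1 - p) ^+ K.
  apply: le_trans (expr1B_ge_expR K pg g1); rewrite -expRN ler_expR lerN2.
  rewrite ler_pdivrMr; last lra.
  by apply: le_trans Kp2 _; rewrite /ep; lra.
have r0 : 0 < z / s by rewrite divr_gt0 //; lra.
have [u [u0 ugt ule]] := nat_above (ltW r0).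
have zs : z / s * p = s ^+ 3 * l.
  by rewrite mulrAC ZE -sE; field; rewrite lt0r_neq0 //; lra.
have Zla0 : 0 <= z * p / la by apply: divr_ge0; exact: ltW.
have [t [t0 tgt tle]] := nat_above Zla0.
have s14 : s <= s ^+ 4 by rewrite ler_eXnr.
have l0 : 0 < l by lra.
(* As [l >= 1], this absorbs the rounding in [b] and [t]; it also makes [t] exceed [3 * l]. *)
have Z3 : 3 * l <= z * p / la.
  rewrite ler_pdivlMr // ZE -sE -mulrA [3 * _]mulrC -mulrA [leRHS]mulrC ler_pM2l //.
  by lra.
have zK0 : 0 <= z / K%:R by apply: divr_ge0 => //; exact: ltW.
have [b [b0 bgt ble]] := nat_above zK0.
have zK : z / K%:R <= 8 / (1 - gamma) * (z * p / la).
  rewrite ler_pdivrMr ?ltr0n //.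
  set c := 8 / (1 - gamma) in epE *.
  have c0 : 0 <= c by rewrite divr_ge0 //; lra.
  have -> : c * (z * p / la) * K%:R = c * z * (K%:R * p) / la by ring.
  rewrite ler_pdivlMr //; apply: le_trans (_ : c * z * (ep * la) <= _); last first.
    by apply: ler_wpM2l => //; apply: mulr_ge0 => //; exact: ltW.
  have -> : c * z * (ep * la) = c * ep * (z * la) by ring.
  by rewrite epE mul1r.
exists (b + t.*2)%N.
  by rewrite -muln2 natrD natrM mulrDl; lra.
have p01 : 0 < p < 1 by rewrite p0.
have p01' : 0 < p <= 1 by rewrite p0 ltW.
have p01'' : 0 <= p <= 1 by rewrite !ltW.
have sparse : gnp_prob p (fun E : {set 'I_n * 'I_n} =>
    `[< exists2 W : {set 'I_n}, #|W|%:R <= z / s & ~ proper_on E W t.*2 >]) <= 1 / n%:R.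
  have e4 := expR1_le4 R; have e0 := expR_gt0 (1 : R).
  have s0 : 0 < s by lra.
  have zs16 : 16 * (p * (z / s)) <= t%:R.
    apply: le_trans (ltW tgt); rewrite ler_pdivlMr //.
    have -> : 16 * (p * (z / s)) * la = z * p * (16 * la) / s by ring.
    by rewrite ler_pdivrMr // ler_pM2l.
  have t0' : 0 < t%:R :> R by rewrite ltr0n.
  set i := n%:R^-1 : R.
  have n0 : 0 < n%:R :> R by apply: lt_le_trans n2'.
  have i0 : 0 < i by rewrite invr_gt0.
  have ni : n%:R * i = 1 by rewrite mulfV // lt0r_neq0.
  have i2 : i <= 1 / 2 by clear -i0 ni n2'; nra.
  (* As e^2 <= 16, the base is at most 1 / e, and [t > 3 * l] gives n^(-3). *)
  have w3 : (expR 1 * p * (z / s) / t%:R) ^+ t <= i ^+ 3.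
    apply: le_trans (_ : expR (- 1) ^+ t <= _).
      apply: lerXn2r; rewrite ?nnegrE ?expR_ge0 //.
        apply/ltW/divr_gt0 => //; apply: mulr_gt0 => //; apply: mulr_gt0 => //.
      rewrite ler_pdivrMr // expRN ler_pdivlMl //; apply: le_trans zs16.
      have -> : expR 1 * (expR 1 * p * (z / s)) = expR 1 ^+ 2 * (p * (z / s)) by ring.
      by apply: ler_wpM2r; [apply/ltW/mulr_gt0|clear -e4 e0; nra].
    have -> : i = expR (- l) by rewrite expRN nE.
    by rewrite -!expRM_natl ler_expR; clear -tgt Z3; lra.
  have nw : n%:R * (expR 1 * p * (z / s) / t%:R) ^+ t <= i * i.
    apply: le_trans (_ : n%:R * i ^+ 3 <= _); first by rewrite ler_pM2l.
    by rewrite exprS mulrA ni mul1r expr2.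
  have n1 : (0 < n)%N by apply: leq_trans n2.
  have nw2 : n%:R * (expR 1 * p * (z / s) / t%:R) ^+ t <= 1 / 2.
    by apply: le_trans nw _; clear -i0 i2; nra.
  apply: le_trans (gnp_locally_sparse p01' n1 t0 r0 nw2) _.
  by rewrite div1r -/i; clear -nw i0 i2; move: nw; set w := n%:R * _; nra.
have indep : gnp_prob p (fun E : {set 'I_n * 'I_n} => `[< exists2 U : {set 'I_n}, #|U| = u &
      forall I : {set 'I_n}, I \subset U -> independent E I -> (#|I| <= K)%N >]) <= 1 / n%:R.
  have s0 : 0 < s by lra.
  have s2 : s <= s ^+ 2 by rewrite ler_eXnr.
  have s3 : s <= s ^+ 3 by rewrite ler_eXnr.
  have epla8 : ep * la <= 1 / 8 * la by rewrite ler_pM2r.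
  apply: gnp_small_independence => //.
    rewrite -(ler_nat R) -muln2 natrM; apply: le_trans (ltW ugt).
    rewrite -(ler_pM2r p0) zs.
    have : s ^+ 3 * 1 <= s ^+ 3 * l by rewrite ler_pM2l // exprn_gt0.
    by rewrite mulrAC; lra.
  apply: le_trans (_ : z / s * s^-1 <= _); last first.
    by apply: ler_pM => //; [exact: ltW|rewrite invr_ge0 ltW|exact: ltW].
  (* Multiplied by [p], the left side is at most 48 ep la l <= 6 la l <= s l, and the right side
     becomes s^2 l. *)
  rewrite -(ler_pM2r p0).
  have -> : z / s * s^-1 * p = s ^+ 2 * l.
    by rewrite mulrAC zs; field; rewrite lt0r_neq0.
  rewrite [leRHS]mulrC -[24 * l]mulrC -!mulrA ler_pM2l //.
  by lra.
have -> : 2 / n%:R = 1 / n%:R + 1 / n%:R :> R by lra.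
apply: le_trans (lerD sparse indep); apply: gnp_prob_leU => // E /asboolP[W Wz nW].
apply/orP; apply: contrapT => /not_orP[small big]; apply: nW.
apply: (@proper_on_peel _ _ u K).
(* Since [u <= z / s + 1], fewer than [u] vertices means at most [z / s]. *)
- move=> S Su; apply: contrapT => nS; apply: small; apply/asboolP; exists S => //.
  by rewrite -(lerD2r 1) natr1; apply: le_trans ule; rewrite ler_nat.
- move=> U cU; apply: contrapT => none; apply: big; apply/asboolP; exists U => // I IU indI.
  by rewrite leqNgt; apply/negP => KI; apply: none; exists I.
- apply: ltn_addl; rewrite -(ltr_nat R); apply: le_lt_trans Wz _.
  by rewrite natrM -ltr_pdivrMr ?ltr0n.
Qed.

(** * Passage to the limit *)

Local Open Scope classical_set_scope.

Lemma cvg_to1 (R : realType) (omega P : nat -> R) :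
  omega @ \oo --> +oo -> (forall n, P n <= 1) ->
  (\forall n \near \oo, 1 - 8 / omega n ^+ 2 - 2 / n%:R <= P n) ->
  P @ \oo --> (1 : R).
Proof.
move=> om P1 lower; apply/cvgrPdist_le => e e0.
have om_big : \forall n \near \oo, 16 / e + 1 <= omega n by move/cvgryPge: om; apply.
have n_big : \forall n \near \oo, 4 / e + 1 <= (n%:R : R) by move/cvgryPge: (@cvgr_idn R); apply.
near=> n; have Pn := P1 n; rewrite ger0_norm ?subr_ge0 //.
have : 1 - 8 / omega n ^+ 2 - 2 / n%:R <= P n by near: n.
have omn : 16 / e + 1 <= omega n by near: n.
have nn : 4 / e + 1 <= (n%:R : R) by near: n.
have ie0 : 0 < e^-1 by rewrite invr_gt0.
have eK : e * e^-1 = 1 by rewrite mulfV // lt0r_neq0.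
have : 8 / omega n ^+ 2 <= e / 2.
  rewrite ler_pdivrMr; last by rewrite exprn_gt0 //; lra.
  have : omega n <= omega n ^+ 2 by rewrite ler_eXnr //; lra.
  have : e * (16 / e + 1) <= e * omega n by rewrite ler_pM2l.
  by nra.
have : 2 / n%:R <= e / 2.
  rewrite ler_pdivrMr; last lra.
  have : e * (4 / e + 1) <= e * n%:R by rewrite ler_pM2l.
  by nra.
lra.
Unshelve. all: by end_near.
Qed.

Lemma near_ln_nat_ge1 (R : realType) : \forall n \near \oo, 1 <= ln (n%:R : R).
Proof.
have : \forall n \near \oo, expR 1 <= (n%:R : R) by move/cvgryPge: (@cvgr_idn R); apply.
apply: filterS => n en; rewrite -[leLHS]expRK ler_ln ?posrE ?expR_gt0 //.
exact: lt_le_trans (expR_gt0 1) en.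
Qed.

Theorem theorem3 (R : realType) (gamma : R) (hgamma : 0 < gamma < 1) :
  exists C : R, 0 < C /\
  forall (omega p : nat -> R),
    omega @ \oo --> +oo ->
    (forall n, 0 < p n <= gamma) ->
    let z := fun n : nat => omega n * Num.sqrt (n%:R : R) in
    ((fun n => z n * p n / ln (n%:R : R)) @ \oo --> +oo ->
      exists a : nat -> R,
        (fun n => gnp_prob (p n) (fun E : {set 'I_n * 'I_n} =>
            (a n <= (chi E)%:R) &&
            ((chi E)%:R <= a n + C * z n * p n / ln (z n * p n / ln (n%:R : R)))))
        @ \oo --> (1 : R)) /\
    ((fun n => z n * p n / ln (n%:R : R)) @ \oo --> (0 : R) ->
      exists a : nat -> R,
        (fun n => gnp_prob (p n) (fun E : {set 'I_n * 'I_n} =>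
            (a n <= (chi E)%:R) &&
            ((chi E)%:R <= a n + C * ln (n%:R : R) / ln (ln (n%:R : R) / (z n * p n)))))
        @ \oo --> (1 : R)).
Proof.
have [g0 g1] := andP hgamma.
have c0 : 0 < 8 / (1 - gamma) by rewrite divr_gt0 // subr_gt0.
(* The dense range needs 8 / (1 - gamma) + 5 and the sparse range 24; this value covers both. *)
exists (8 / (1 - gamma) + 24); split; first by lra.
set C := 8 / (1 - gamma) + 24.
move=> omega p om hp z.
have p01 n : 0 < p n < 1 by have /andP[p0 pg] := hp n; lra.
have p01' n : 0 <= p n <= 1 by have /andP[p0 p1] := p01 n; rewrite !ltW.
have om3 : \forall n \near \oo, 3 <= omega n by move/cvgryPge: om; apply.
have ln1 := near_ln_nat_ge1 R.
split=> lim.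
  pose L n := C * z n * p n / ln (z n * p n / ln (n%:R : R)).
  (* The threshold puts the logarithm above both 1024 and 8 / (1 - gamma). *)
  have big : \forall n \near \oo, expR (1024 + 8 / (1 - gamma)) <= z n * p n / ln (n%:R : R).
    by move/cvgryPge: lim; apply.
  (* The left endpoint is chosen separately for each [n]; where the conditions fail, which happens
     only finitely often, it defaults to 0. *)
  have /choice[a aP] : forall n, exists a : R,
    [/\ 3 <= omega n, 1 <= ln (n%:R : R) &
        expR (1024 + 8 / (1 - gamma)) <= z n * p n / ln (n%:R : R)] ->
    1 - 8 / omega n ^+ 2 - 2 / n%:R <= gnp_prob (p n) (fun E : {set 'I_n * 'I_n} =>
      (a <= (chi E)%:R) && ((chi E)%:R <= a + L n)).
    move=> n; case: (pselect [/\ 3 <= omega n, 1 <= ln (n%:R : R) &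
        expR (1024 + 8 / (1 - gamma)) <= z n * p n / ln (n%:R : R)]); last by exists 0.
    move=> [om3n ln1n bign].
    have om2n : 2 < omega n by lra.
    have z0 : 0 < z n by have := sqrt_scale_ge2 ln1n om2n; rewrite -/(z n); lra.
    have dpos := lt_le_trans (expR_gt0 _) bign.
    have la : 1024 + 8 / (1 - gamma) <= ln (z n * p n / ln (n%:R : R)).
      by rewrite -[leLHS]expRK ler_ln ?posrE ?expR_gt0.
    have [||k kL bad] := @gnp_small_sets_dense R n (p n) gamma (z n) (hp n) g1 ln1n z0.
    - by lra.
    - by lra.
    have Zla : 0 <= z n * p n / ln (z n * p n / ln (n%:R : R)).
      have /andP[p0 _] := p01 n.
      by apply: divr_ge0; [apply/mulr_ge0; exact: ltW|lra].
    have [|a aP] := @chi_interval R n (p n) (omega n) (p01 n) ln1n om2n k (L n) _ bad.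
      apply: le_trans kL _.
      have -> : L n = C * (z n * p n / ln (z n * p n / ln (n%:R : R))) by rewrite /L !mulrA.
      by apply: ler_wpM2r => //; rewrite /C; lra.
    by exists a.
  exists a; apply: (cvg_to1 om) => [n|]; first exact: gnp_prob_le1.
  by near=> n; apply: aP; split; near: n.
pose L n := C * ln (n%:R : R) / ln (ln (n%:R : R) / (z n * p n)).
have small : \forall n \near \oo, z n * p n / ln (n%:R : R) <= 1 / 2.
  by apply: (cvgr_le _ lim); lra.
have /choice[a aP] : forall n, exists a : R,
    [/\ 3 <= omega n, 1 <= ln (n%:R : R) & z n * p n / ln (n%:R : R) <= 1 / 2] ->
    1 - 8 / omega n ^+ 2 - 2 / n%:R <= gnp_prob (p n) (fun E : {set 'I_n * 'I_n} =>
      (a <= (chi E)%:R) && ((chi E)%:R <= a + L n)).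
  move=> n; case: (pselect [/\ 3 <= omega n, 1 <= ln (n%:R : R) &
      z n * p n / ln (n%:R : R) <= 1 / 2]); last by exists 0.
  move=> [om3n ln1n smalln].
  have om2n : 2 < omega n by lra.
  have z0 : 0 < z n by have := sqrt_scale_ge2 ln1n om2n; rewrite -/(z n); lra.
  have zp0 : 0 < z n * p n by rewrite mulr_gt0 //; case/andP: (p01 n).
  have [||a aP] := @chi_interval_sparse R n (p n) (omega n) (p01 n) ln1n om2n C.
  - by rewrite /C; lra.
  - rewrite -/(z n) ltr_pdivlMr // mul1r.
    by move: smalln; rewrite ler_pdivrMr; lra.
  by exists a.
exists a; apply: (cvg_to1 om) => [n|]; first exact: gnp_prob_le1.
by near=> n; apply: aP; split; near: n.
Unshelve. all: by end_near.
Qed.
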